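(* Let $G=(V,E)$ be a connected finite graph with positive vertex measure $\mu$ and positive symmetric edge weights $w_{xy}$. Let $h_1,h_2:V\to\mathbb{R}$ be two given functions with $h_1(x)>0$ and $h_2(x)>0$ for all $x\in V$, and let $A,B>0$ be two constants. If $A\max_V h_1<B\min_V h_2$ or $A\min_V h_1>B\max_V h_2$, then the equation $$-\Delta u+h_1(x)e^{Au}(e^{Au}-1)+h_2(x)e^{-Bu}(e^{-Bu}-1)=0\quad\text{on } V$$ has at least two solutions $u:V\to\mathbb{R}$.
   Context: $G=(V,E)$ is a connected finite graph with measure $\mu:V\to(0,+\infty)$ and weights $\{w_{xy}:xy\in E\}$, where $w_{xy}=w_{yx}>0$. The Laplacian of $u:V\to\mathbb{R}$ is $$\Delta u(x)=\frac{1}{\mu(x)}\sum_{y\sim x}w_{xy}(u(y)-u(x)),$$ where $y\sim x$ means $xy\in E$. A solution is a function $u:V\to\mathbb{R}$ satisfying the equation at every $x\in V$. *)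

(* Defs.v *)
From HB Require Import structures.
From mathcomp Require Import all_boot all_order all_algebra.
From mathcomp Require Import reals sequences exp.

Set Implicit Arguments.
Unset Strict Implicit.
Unset Printing Implicit Defensive.

Import Order.TTheory GRing.Theory Num.Theory.
Local Open Scope ring_scope.

Definition simple_graph (V : finType) (E : rel V) : Prop :=
  symmetric E /\ irreflexive E.

Definition connected_graph (V : finType) (E : rel V) : Prop :=
  forall x y : V, connect E x y.

(* [w] is total on pairs of vertices; its values off the edges are
   unconstrained and never used. *)
Definition edge_weights (R : realType) (V : finType) (E : rel V)
    (w : V -> V -> R) : Prop :=
  forall x y : V, E x y -> w x y = w y x /\ 0 < w x y.

Definition laplacian (R : realType) (V : finType) (E : rel V) (mu : V -> R)
    (w : V -> V -> R) (u : V -> R) (x : V) : R :=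
  (mu x)^-1 * \sum_(y : V | E x y) w x y * (u y - u x).

(* The vertex [x0] witnesses that [V] is nonempty; the values of [maxV] and
   [minV] do not depend on it. *)
Definition maxV (R : realType) (V : finType) (x0 : V) (h : V -> R) : R :=
  \big[Num.max/h x0]_(x : V) h x.

Definition minV (R : realType) (V : finType) (x0 : V) (h : V -> R) : R :=
  \big[Num.min/h x0]_(x : V) h x.

Definition is_solution (R : realType) (V : finType) (E : rel V) (mu : V -> R)
    (w : V -> V -> R) (h1 h2 : V -> R) (A B : R) (u : V -> R) : Prop :=
  forall x : V,
    - laplacian E mu w u x
    + h1 x * expR (A * u x) * (expR (A * u x) - 1)
    + h2 x * expR (- B * u x) * (expR (- B * u x) - 1) = 0.

(* Main.v *)
(** Put [g(t) = a e^{At} (e^{At} - 1) + b e^{-Bt} (e^{-Bt} - 1)] with [aA < bB]: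
    [g] vanishes at 0, is negative just to the right of 0 and positive far to the
    right.  The zero function is one solution.  In the first case (a = h1, b = h2)
    the equation is [-Δu + g(u) = 0], so small positive constants are subsolutions
    and large ones supersolutions; minimizing the energy over the box of functions
    between them gives a positive solution.  In the second case the substitution
    [u = -v] gives [-Δv = g(v)] (with the roles of (h1, A) and (h2, B) exchanged),
    where [g(t)/t] is strictly increasing on t > 0, and a nonzero [v >= 0] is found
    by minimization over the Nehari set. *)

Require Import Defs.
From HB Require Import structures.
From mathcomp Require Import all_boot all_order all_algebra.
From mathcomp Require Import reals sequences exp.
From mathcomp Require Import boolp classical_sets functions topology normedtype.
From mathcomp Require Import derive realfun ring lra.

Set Implicit Arguments.
Unset Strict Implicit.
Unset Printing Implicit Defensive.

Import Order.TTheory GRing.Theory Num.Theory.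
Local Open Scope ring_scope.

Import numFieldNormedType.Exports.

(** * One-sided calculus on the real line *)

Section RealVariable.
Local Open Scope classical_set_scope.
Variable R : realType.
Implicit Types (f : R -> R) (a df x : R).

Lemma is_derive_continuous f x df : is_derive x 1 f df -> {for x, continuous f}.
Proof.
by move=> [? _]; apply: differentiable_continuous; apply/derivable1_diffP.
Qed.

Lemma is_derive_bigsum (I : finType) (h : I -> R -> R) (dh : I -> R) x :
  (forall i, is_derive x 1 (h i) (dh i)) ->
  is_derive x 1 (fun t => \sum_i h i t) (\sum_i dh i).
Proof.
move=> Hh.
have -> : (fun t => \sum_i h i t) = \sum_i h i.
  by apply/funext => t; rewrite fct_sumE.
elim/big_ind2 : _ => // [|f df g dg *]; first exact: is_derive_cst.
exact: is_deriveD.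
Qed.

Lemma near_right_lt_of_derive_lt0 f df :
  is_derive (0 : R) 1 f df -> df < 0 -> \forall s \near 0^'+, f s < f 0.
Proof.
move=> [Df <-] dflt0; near=> s.
have s0 : 0 < s by near: s; exact: nbhs_right_gt.
have : s^-1 *: (f (s *: 1 + 0) - f 0) < 0.
  near: s; apply: (cvgr_lt ('D_1 f 0)) => //.
  exact: (cvg_dnbhs_at_right Df).
rewrite addr0 [s *: 1]mulr1 pmulr_rlt0 ?invr_gt0//.
by rewrite subr_lt0.
Unshelve. all: by end_near. Qed.

Lemma near_right_lt f df a :
  is_derive (0 : R) 1 f df -> f 0 < a -> \forall s \near 0^'+, f s < a.
Proof.
move=> /is_derive_continuous cf fa; apply: (cvgr_lt (f 0)) => //.
exact: cvg_at_right_filter cf.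
Qed.

Lemma ge0_of_derive_ge0 f (f' : R -> R) : f 0 = 0 ->
  (forall t : R, is_derive t 1 f (f' t)) -> (forall t : R, 0 <= t -> 0 <= f' t) ->
  forall t : R, 0 <= t -> 0 <= f t.
Proof.
move=> f0 Df f'0 t t0; rewrite -f0.
apply: (@ger0_derive1_le_cc _ f 0 t) => //.
- move=> y; rewrite in_itv/= => /andP[/ltW/f'0 + _].
  by rewrite derive1E (@derive_val _ _ _ _ _ _ _ (Df y)).
- by apply: continuous_subspaceT => y; exact: is_derive_continuous (Df y).
- by rewrite in_itv/= lexx.
- by rewrite in_itv/= lexx andbT.
Qed.

Lemma is_derive_quadratic (a b c : R) :
  is_derive (0 : R) 1 (fun s => a + s * b + s ^+ 2 * c) b.
Proof.
have Did := @is_derive_id R R^o 0 1.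
have Db := is_deriveM Did (@is_derive_cst R R^o R^o b 0 1).
have Dc := is_deriveM (is_deriveM Did Did) (@is_derive_cst R R^o R^o c 0 1).
have D := is_deriveD (is_deriveD (@is_derive_cst R R^o R^o a 0 1) Db) Dc.
apply: (is_derive_eq (df := _) D).
by rewrite !(scale0r, scaler0, addr0, add0r) [LHS]mulr1.
Qed.

Lemma is_derive_line f df a d : is_derive a 1 f df ->
  is_derive (0 : R) 1 (fun s => f (a + s * d)) (d * df).
Proof.
move=> Df; rewrite mulrC.
have Dl : is_derive (0 : R) 1 (fun s => a + s * d) d.
  have -> : (fun s => a + s * d) = (fun s => a + s * d + s ^+ 2 * 0).
    by apply/funext => s; rewrite mulr0 addr0.
  exact: is_derive_quadratic.
apply: (@is_derive1_comp R f (fun s => a + s * d)) Dl.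
by rewrite mul0r addr0.
Qed.

Lemma is_derive_cstM f df x a : is_derive x 1 f df ->
  is_derive x 1 (fun t => a * f t) (a * df).
Proof. exact: is_deriveZ. Qed.
End RealVariable.

(** * Minimization over boxes of functions on [V] *)

Section Box.
Local Open Scope classical_set_scope.
Variables (R : realType) (V : finType).

Lemma continuous_coord (f : R -> R) (x : V) : continuous f ->
  continuous (fun v : {ptws V -> R} => f (v x)).
Proof.
move=> cf v; apply: (@continuous_comp _ _ _ (fun v : {ptws V -> R} => v x) f).
  exact: (@proj_continuous V (fun=> R) x).
exact: cf.
Qed.

Lemma continuous_bigsum (T : topologicalType) (I : finType) (F : I -> T -> R) :
  (forall i, continuous (F i)) -> continuous (fun v => \sum_i F i v).
Proof.
by move=> cF; apply: (@continuous_big R _ _ _ xpredT (@add_continuous _)).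
Qed.

(** The box is compact by Tychonoff in the product topology of [{ptws V -> R}]. The closed set [D]
    leaves room for the Nehari constraints. *)
Lemma box_EVT_min (a b : R) (D : set {ptws V -> R}) (F : {ptws V -> R} -> R) :
  closed D -> continuous F -> (exists2 v, D v & forall x, a <= v x <= b) ->
  exists v, [/\ D v, forall x, a <= v x <= b &
    forall w, D w -> (forall x, a <= w x <= b) -> F v <= F w].
Proof.
move=> cD cF [u Du bu].
pose box : set {ptws V -> R} := [set v | forall x, `[a, b] (v x)].
have cbox : compact box.
  by apply: (@tychonoff V (fun=> R) (fun=> `[a, b])) => _; exact: segment_compact.
have cDbox : compact (D `&` box).
  by rewrite setIC; apply: compact_closedI.
have boxP v : box v <-> forall x, a <= v x <= b.
  by split => bv x; have := bv x; rewrite /= in_itv.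
have [|||v] := @compact_EVT_min _ R F (D `&` box).
- by exists u; split => //; apply/boxP.
- exact: cDbox.
- exact: continuous_subspaceT.
rewrite inE => -[Dv /boxP bv] vmin; exists v; split => // w Dw bw.
by apply: vmin; rewrite inE; split => //; apply/boxP.
Qed.

(** Coordinates strictly inside a bound stay there for small [s], and those on a bound do not leave,
    by the sign of [d]. As [V] is finite, one [s] serves all vertices. *)
Lemma near_right_box (a b : R) (v d : V -> R) : (forall x, a <= v x <= b) ->
  (forall x, v x = a -> 0 <= d x) -> (forall x, v x = b -> d x <= 0) ->
  \forall s \near 0^'+, forall x, a <= v x + s * d x <= b.
Proof.
move=> bv da db; apply: filter_forall => x.
have D c : is_derive (0 : R) 1 (fun s => c * (v x + s * d x)) (c * d x).
  apply: (@is_derive_cstM R (fun s => v x + s * d x)).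
  by have := @is_derive_line R id 1 (v x) (d x); rewrite mulr1; apply.
have s0 : \forall s \near 0^'+, (0 : R) < s by exact: nbhs_right_gt.
have [av vb] := andP (bv x).
have lo : \forall s \near 0^'+, a <= v x + s * d x.
  have [/da dx|ne] := eqVneq (v x) a.
    by apply: filterS s0 => s s0; rewrite (le_trans av)// lerDl mulr_ge0// ltW.
  have : \forall s \near 0^'+, -1 * (v x + s * d x) < - a.
    apply: near_right_lt (D (-1)) _.
    by rewrite mul0r addr0 mulN1r ltrN2 lt_neqAle eq_sym ne.
  by apply: filterS => s; rewrite mulN1r ltrN2 => /ltW.
have hi : \forall s \near 0^'+, v x + s * d x <= b.
  have [/db dx|ne] := eqVneq (v x) b.
    by apply: filterS s0 => s s0; rewrite (le_trans _ vb)// gerDl mulr_ge0_le0// ltW.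
  have : \forall s \near 0^'+, 1 * (v x + s * d x) < b.
    by apply: near_right_lt (D 1) _; rewrite mul0r addr0 mul1r lt_neqAle ne.
  by apply: filterS => s; rewrite mul1r => /ltW.
by near=> s; apply/andP; split; near: s.
Unshelve. all: by end_near. Qed.

Lemma is_derive_potential (m v d : V -> R) (f f' : V -> R -> R) :
  (forall x (t : R), is_derive t 1 (f x) (f' x t)) ->
  is_derive (0 : R) 1 (fun s => \sum_x m x * f x (v x + s * d x))
    (\sum_x m x * (d x * f' x (v x))).
Proof.
move=> Df; apply: is_derive_bigsum => x.
by apply: is_derive_cstM; exact: is_derive_line.
Qed.

Lemma continuous_potential (m : V -> R) (f : V -> R -> R) :
  (forall x, continuous (f x)) ->
  continuous (fun v : {ptws V -> R} => \sum_x m x * f x (v x)).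
Proof.
move=> cf; apply: continuous_bigsum => x v.
have cx := @continuous_coord (f x) x (cf x).
exact: cvgM (cvg_cst (m x)) (cx v).
Qed.
(** Directions supported at one vertex turn first-order inequalities for minimizers into pointwise
    ones. *)
Lemma sum_delta (F : V -> R) (c : R) x :
  \sum_y (if y == x then c else 0) * F y = c * F x.
Proof.
rewrite (bigD1 x)//= eqxx big1 ?addr0// => y /negPf ->; exact: mul0r.
Qed.

End Box.

(** * The weighted graph Laplacian and its Dirichlet energy *)

Section Energy.
Variables (R : realType) (V : finType) (k : V -> V -> R).
Hypotheses (k_sym : forall x y, k x y = k y x) (k_ge0 : forall x y, 0 <= k x y).
Implicit Types u v d : V -> R.

(** This is [-Δ] multiplied by the vertex measure, for edge weights [k] extended by zero; for
    symmetric [k], [energy] is half the sum of [k x y * (v x - v y) ^+ 2] over ordered pairs. *)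
Definition lap v x : R := \sum_y k x y * (v x - v y).
Definition energy v : R := \sum_x v x * lap v x.

Lemma lap_sym u v : \sum_x u x * lap v x = \sum_x v x * lap u x.
Proof.
have E a b : \sum_x a x * lap b x =
    \sum_x \sum_y k x y * (a x * b x) - \sum_x \sum_y k x y * (a x * b y).
  rewrite -sumrB; apply: eq_bigr => x _; rewrite mulr_sumr -sumrB.
  by apply: eq_bigr => y _; ring.
rewrite !E; congr (_ - _).
  by apply: eq_bigr => x _; apply: eq_bigr => y _; ring.
rewrite exchange_big; apply: eq_bigr => x _; apply: eq_bigr => y _ /=.
by rewrite k_sym; ring.
Qed.

(** Adding to the double sum its copy with [x] and [y] exchanged leaves weighted squares of
    differences. *)
Lemma energy_ge0 v : 0 <= energy v.
Proof.
have E : energy v = \sum_x \sum_y k x y * (v y * (v y - v x)).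
  rewrite exchange_big; apply: eq_bigr => x _; rewrite mulr_sumr.
  by apply: eq_bigr => y _; rewrite k_sym; ring.
suff : 0 <= energy v + energy v by lra.
rewrite {2}E -big_split/=; apply: sumr_ge0 => x _.
rewrite mulr_sumr -big_split/=; apply: sumr_ge0 => y _.
have -> : v x * (k x y * (v x - v y)) + k x y * (v y * (v y - v x)) =
  k x y * (v x - v y) ^+ 2 by ring.
by rewrite mulr_ge0// sqr_ge0.
Qed.

Lemma lap_line v d (s : R) x :
  lap (fun y => v y + s * d y) x = lap v x + s * lap d x.
Proof.
by rewrite /lap mulr_sumr -big_split/=; apply: eq_bigr => y _; ring.
Qed.

Lemma energy_line v d (s : R) : energy (fun y => v y + s * d y) =
  energy v + s * (2 * \sum_x d x * lap v x) + s ^+ 2 * energy d.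
Proof.
rewrite mulr_natl mulr2n {2}lap_sym /energy !mulrDr !mulr_sumr -!big_split/=.
by apply: eq_bigr => x _; rewrite lap_line; ring.
Qed.

Lemma is_derive_energy v d :
  is_derive (0 : R) 1 (fun s => energy (fun y => v y + s * d y))
    (\sum_x 2 * (d x * lap v x)).
Proof.
rewrite -mulr_sumr.
have -> : (fun s => energy (fun y => v y + s * d y)) = (fun s =>
    energy v + s * (2 * \sum_x d x * lap v x) + s ^+ 2 * energy d).
  by apply/funext => s; exact: energy_line.
exact: is_derive_quadratic.
Qed.

Lemma continuous_energy :
  continuous (fun v : {ptws V -> R} => energy v).
Proof.
have cp (x : V) : continuous (fun v : {ptws V -> R} => v x).
  by apply: (@continuous_coord R V id x) => t; exact: cvg_id.
have cl (x : V) : continuous (fun v : {ptws V -> R} => lap v x).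
  apply: (@continuous_bigsum R {ptws V -> R} V (fun y w => k x y * (w x - w y))).
  have cB y : continuous (fun w : {ptws V -> R} => w x - w y).
    by move=> w; exact: cvgB (cp x w) (cp y w).
  by move=> y w; exact: cvgM (cvg_cst (k x y)) (cB y w).
apply: (@continuous_bigsum R {ptws V -> R} V (fun x v => v x * lap v x)) => x v.
exact: cvgM (cp x v) (cl x v).
Qed.

(** With [lap_ge0], the discrete maximum principle: at an extremum all terms have one sign. *)
Lemma lap_le0 v x : (forall y, v x <= v y) -> lap v x <= 0.
Proof. by move=> vx; apply: sumr_le0 => y _; rewrite mulr_ge0_le0// subr_le0. Qed.

Lemma lap_ge0 v x : (forall y, v y <= v x) -> 0 <= lap v x.
Proof. by move=> vx; apply: sumr_ge0 => y _; rewrite mulr_ge0// subr_ge0. Qed.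

Lemma energy_cst (c : R) : energy (fun=> c) = 0.
Proof.
by rewrite /energy big1// => x _; rewrite /lap big1 ?mulr0// => y _; rewrite subrr mulr0.
Qed.

End Energy.

(** * A solution between constant sub- and supersolutions *)

Section Ordered.
Local Open Scope classical_set_scope.
Variables (R : realType) (V : finType) (k : V -> V -> R) (m : V -> R).
Hypotheses (k_sym : forall x y, k x y = k y x) (k_ge0 : forall x y, 0 <= k x y).
Hypothesis m_gt0 : forall x, 0 < m x.
Variables (g G : V -> R -> R).
Hypothesis DG : forall x (t : R), is_derive t 1 (G x) (g x t).

(** A minimizer of the energy over the box touches neither wall: there the signs of [lap] and [g]
    agree, so a push inward would lower the energy. All directions are then admissible and the
    Euler-Lagrange equation holds. *)
Lemma solution_between_constants (a b : R) : a <= b ->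
  (forall x, g x a < 0) -> (forall x, 0 < g x b) ->
  exists v : V -> R, (forall x, a <= v x) /\
    (forall x, lap k v x + m x * g x (v x) = 0).
Proof.
move=> ab ga gb.
(* Twice the usual functional, whence the factor [2 * m x]. *)
pose J (v : {ptws V -> R}) := energy k v + \sum_x (2 * m x) * G x (v x).
have cG x : continuous (G x) by move=> t; exact: is_derive_continuous (DG x t).
have cJ : continuous J.
  move=> v.
  exact: cvgD (@continuous_energy R V k v)
    (@continuous_potential R V (fun x => 2 * m x) G cG v).
have [|v [_ bv vmin]] := @box_EVT_min R V a b setT J closedT cJ.
  by exists (fun=> a) => // x; rewrite lexx ab.
(* For a direction [d] that does not point out of the box, a negative derivative would make
   [v + s d] a better competitor for small [s > 0]. *)
have first_order d : (forall x, v x = a -> 0 <= d x) ->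
    (forall x, v x = b -> d x <= 0) ->
    0 <= \sum_x d x * (lap k v x + m x * g x (v x)).
  move=> da db; rewrite leNgt; apply/negP => dJ0.
  have DJ : is_derive (0 : R) 1 (fun s => J (fun x => v x + s * d x))
      (\sum_x 2 * (d x * lap k v x) + \sum_x (2 * m x) * (d x * g x (v x))).
    apply: is_deriveD; first exact: is_derive_energy.
    exact: is_derive_potential.
  have /(near_right_lt_of_derive_lt0 DJ) desc :
    \sum_x 2 * (d x * lap k v x) + \sum_x (2 * m x) * (d x * g x (v x)) < 0.
    rewrite -big_split/= (eq_bigr (fun x =>
      2 * (d x * (lap k v x + m x * g x (v x))))); last by move=> x _; ring.
    by rewrite -mulr_sumr pmulr_rlt0.
  near (0 : R)^'+ => s.
  have : J (fun x => v x + s * d x) < J (fun x => v x + 0 * d x) by near: s.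
   rewrite ltNge => /negP; apply.
  have -> : (fun x => v x + 0 * d x) = v by apply/funext => x; rewrite mul0r addr0.
  by apply: vmin => //; near: s; exact: near_right_box.
have va x : v x != a.
  apply/eqP => vxa.
  have := first_order (fun y => if y == x then 1 else 0).
  rewrite sum_delta mul1r => H.
  suff : 0 <= lap k v x + m x * g x (v x).
    apply/negP; rewrite -ltNge -[ltRHS]addr0 ler_ltD//.
      by apply: lap_le0 => // y; rewrite vxa; case/andP: (bv y).
    by rewrite vxa pmulr_rlt0.
  apply: H => y; first by case: ifP.
  (* If [x] were also at the upper wall, then [a = b], against [g x a < 0 < g x b]. *)
  case: eqP => // -> vxb; have := ga x; rewrite -vxa vxb => /lt_trans/(_ (gb x)).
  by rewrite ltxx.
have vb x : v x != b.
  apply/eqP => vxb.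
  have := first_order (fun y => if y == x then -1 else 0).
  rewrite sum_delta mulN1r oppr_ge0 => H.
  suff : lap k v x + m x * g x (v x) <= 0.
    apply/negP; rewrite -ltNge -[ltLHS]addr0 ler_ltD//.
      by apply: lap_ge0 => // y; rewrite vxb; case/andP: (bv y).
    by rewrite vxb mulr_gt0.
  apply: H => y; last by case: ifP; rewrite ?lerN10.
  by move=> vya; have := va y; rewrite vya eqxx.
exists v; split=> x; first by case/andP: (bv x).
apply/eqP; rewrite eq_le; apply/andP; split.
  rewrite -oppr_ge0 -mulN1r -(sum_delta (fun x => lap k v x + m x * g x (v x))).
  by apply: first_order => y /eqP; rewrite ?(negPf (va y)) ?(negPf (vb y)).
rewrite -[leRHS]mul1r -(sum_delta (fun x => lap k v x + m x * g x (v x))).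
by apply: first_order => y /eqP; rewrite ?(negPf (va y)) ?(negPf (vb y)).
Unshelve. all: by end_near. Qed.

End Ordered.

(** * Minimization under the Nehari constraint *)

Section Nehari.
Local Open Scope classical_set_scope.
Variables (R : realType) (V : finType) (k : V -> V -> R) (m : V -> R).
Hypotheses (k_sym : forall x y, k x y = k y x) (k_ge0 : forall x y, 0 <= k x y).
Hypothesis m_gt0 : forall x, 0 < m x.
Variables (g g' G : V -> R -> R) (c : V -> R).
Hypothesis DG : forall x (t : R), is_derive t 1 (G x) (g x t).
Hypothesis Dg : forall x (t : R), is_derive t 1 (g x) (g' x t).
Hypotheses (g0 : forall x, g x 0 = 0) (G0 : forall x, G x 0 = 0).
Hypothesis c_gt0 : forall x, 0 < c x.
Hypothesis superlinear :
  forall x t, 0 <= t -> c x * t ^+ 2 <= t * g' x t - g x t.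

Let p x t := t * g x t.
Let h x t := t * g x t / 2 - G x t.

Let Dp x (t : R) : is_derive t 1 (p x) (g x t + t * g' x t).
Proof.
have D := is_deriveM (@is_derive_id R R^o t 1) (Dg x t).
by apply: (is_derive_eq (df := _) D); rewrite addrC [in LHS]/GRing.scale/= mulr1.
Qed.

Let Dh x (t : R) : is_derive t 1 (h x) ((t * g' x t - g x t) / 2).
Proof.
have D := is_deriveB (is_derive_cstM 2^-1 (Dp x t)) (DG x t).
have -> : h x = (fun t => 2^-1 * p x t) - G x.
  by apply/funext => s; rewrite /h mulrC.
by apply: (is_derive_eq (df := _) D); lra.
Qed.

(** Integrate from [0]: the derivative of [h x] is half of [t * g' x t - g x t], which [superlinear]
    bounds below. The cubic growth later confines the minimizer to the interior of a box from
    above. *)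
Let h_ge x t : 0 <= t -> c x * t ^+ 3 / 6 <= h x t.
Proof.
move=> t0; rewrite -subr_ge0.
apply: (@ge0_of_derive_ge0 R (fun t => h x t - c x * t ^+ 3 / 6)
  (fun t => (t * g' x t - g x t) / 2 - c x * t ^+ 2 / 2)) t0.
- by rewrite /h g0 G0; ring.
- move=> s.
  have Di := @is_derive_id R R^o s 1.
  have D := is_deriveB (Dh x s)
    (is_derive_cstM (c x / 6) (is_deriveM Di (is_deriveM Di Di))).
  have -> : (fun t => h x t - c x * t ^+ 3 / 6) =
      h x - (fun t => c x / 6 * (id * (id * id)) t).
    by apply/funext => r /=; rewrite !fctE; ring.
  by apply: (is_derive_eq (df := _) D); rewrite !fctE /GRing.scale/=; lra.
- by move=> s s0; have := superlinear x s0; lra.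
Qed.

(** Relaxing the Nehari equality to [N v <= 0] gives a closed condition satisfied by the constant
    [K]. A minimizer of [H] turns out to satisfy [N v = 0], and a correction along [v] converts its
    minimality into the critical point equation of [J]. *)
Theorem nehari_solution (x0 : V) (e K : R) :
  0 < e -> (forall x t, 0 < t -> t <= e -> g x t < 0) ->
  0 < K -> (forall x, 0 <= g x K) ->
  exists v : V -> R, (exists x, v x != 0) /\
    forall x, lap k v x = m x * g x (v x).
Proof.
move=> e0 ge K0 gK.
have h_ge0 x t : 0 <= t -> 0 <= h x t.
  move=> t0; apply: le_trans (h_ge x t0).
  by rewrite divr_ge0// mulr_ge0 ?exprn_ge0// ltW.
have cp x : continuous (p x) by move=> t; exact: is_derive_continuous (Dp x t).
have ch x : continuous (h x) by move=> t; exact: is_derive_continuous (Dh x t).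
(* The Nehari functional [N v = J'(v) v], where
   [J v = energy k v / 2 - \sum_x m x * G x (v x)],
   and [H = J - N/2], which agrees with [J] on the Nehari set. *)
pose N (v : {ptws V -> R}) := energy k v + \sum_x - m x * p x (v x).
pose H (v : {ptws V -> R}) := \sum_x m x * h x (v x).
pose L (v : {ptws V -> R}) := \sum_x 1 * id (v x).
have cN : continuous N.
  move=> v.
  exact: cvgD (@continuous_energy R V k v)
    (@continuous_potential R V (fun x => - m x) p cp v).
have cH : continuous H by exact: continuous_potential.
have cL : continuous L.
  by apply: (@continuous_potential R V (fun=> 1) (fun=> id)) => x t; exact: cvg_id.
(* The constraint [e <= L v] keeps away from the trivial zero of [N]. *)
pose D : set {ptws V -> R} := [set v | N v <= 0] `&` [set v | e <= L v].
have cD : closed D.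
  apply: closedI.
    by apply: (@preimage_closed _ _ N [set r | r <= 0]) => [v _|];
      [exact: (cN v)|exact: closed_le].
  by apply: (@preimage_closed _ _ L [set r | e <= r]) => [v _|];
    [exact: (cL v)|exact: closed_ge].
have eK : e <= K.
  by rewrite leNgt; apply/negP => /ltW /(ge x0 _ K0); rewrite ltNge gK.
have DK : D (fun=> K).
  split=> /=.
    rewrite /N energy_cst add0r; apply: sumr_le0 => x _.
    by rewrite mulNr oppr_le0 mulr_ge0 ?mulr_ge0 ?gK// ltW.
  rewrite /L (bigD1 x0)//= mul1r; apply: (le_trans eK); rewrite lerDl.
  by apply: sumr_ge0 => x _; exact: ltW.
(* A single vertex at height [M] already costs more than the constant [K], so the minimizer cannot
   touch the upper wall. Taking [M >= 1] lets [M ^+ 3] dominate [M]. *)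
have [M [KM MH]] : exists M, K <= M /\ forall x, H (fun=> K) < m x * h x M.
  near (pinfty_nbhs R) => M.
  have M1 : 1 <= M by near: M; apply: nbhs_pinfty_ge; exact: num_real.
  have HM x : H (fun=> K) / (m x * c x / 6) < M.
    move: x; near: M; apply: filter_forall => y.
    by apply: nbhs_pinfty_gt; exact: num_real.
  exists M; split; first by near: M; apply: nbhs_pinfty_ge; exact: num_real.
  move=> x; have M0 : 0 <= M by rewrite (le_trans _ M1).
  apply: lt_le_trans (ler_wpM2l (ltW (m_gt0 x)) (h_ge x M0)).
  have mc : 0 < m x * c x / 6 by rewrite !mulr_gt0// invr_gt0.
  have := HM x; rewrite ltr_pdivrMr// => /lt_le_trans; apply.
  have -> : m x * (c x * M ^+ 3 / 6) = M ^+ 3 * (m x * c x / 6) by ring.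
  by rewrite ler_wpM2r ?(ltW mc)// ler_eXnr.
have [|v [[Nv Lv] bv vmin]] := box_EVT_min (a := 0) (b := M) cD cH.
  by exists (fun=> K) => // x; rewrite KM ltW.
rewrite /= in Nv Lv.
have v0 x : 0 <= v x by case/andP: (bv x).
have vM x : v x != M.
  apply/eqP => vxM.
  have : H v <= H (fun=> K) by apply: vmin => // y; rewrite KM ltW.
  apply/negP; rewrite -ltNge (lt_le_trans (MH x))// /H (bigD1 x)//= vxM lerDl.
  by apply: sumr_ge0 => y _; rewrite mulr_ge0 ?h_ge0// ltW.
(* If all values were at most [e], then [g] would be negative at every positive value, and
   [L v >= e] supplies one; so [N v > 0]. *)
have [z vz] : exists z, e < v z.
  apply/not_existsP => ve.
  have ve' x : v x <= e by rewrite leNgt; apply/negP; exact: ve.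
  have [y vy] : exists y, 0 < v y.
    apply/not_existsP => vn; have : L v <= 0.
      by apply: sumr_le0 => x _; rewrite mul1r leNgt; apply/negP; exact: vn.
    by apply/negP; rewrite -ltNge (lt_le_trans e0).
  have : N v <= 0 by [].
  apply/negP; rewrite -ltNge /N ltr_wpDl ?energy_ge0//.
  rewrite (bigD1 y)//= ltr_pwDl//.
    by rewrite mulNr -mulrN mulr_gt0// oppr_gt0 pmulr_rlt0 ?ge.
  apply: sumr_ge0 => x _; rewrite mulNr -mulrN mulr_ge0//; first exact: ltW.
  rewrite oppr_ge0 /p.
  have := v0 x; rewrite le_eqVlt => /predU1P[<-|vx]; first by rewrite mul0r.
  by rewrite pmulr_rle0// ltW// ge.
have vz0 : 0 < v z by rewrite (lt_trans e0).
(* Strictness makes this constraint inactive under small perturbations. *)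
have eL : e < L v.
  rewrite (lt_le_trans vz)// /L (bigD1 z)//= mul1r lerDl.
  by apply: sumr_ge0 => x _; rewrite mul1r.
(* Directional derivatives of [N], [H], [J] at [v]; so [dN + 2 dH = 2 dJ]. *)
pose dN d := \sum_x 2 * (d x * lap k v x) +
  \sum_x - m x * (d x * (g x (v x) + v x * g' x (v x))).
pose dH d := \sum_x m x * (d x * ((v x * g' x (v x) - g x (v x)) / 2)).
pose dJ d := \sum_x d x * (lap k v x - m x * g x (v x)).
have line0 d : (fun x => v x + 0 * d x) = v.
  by apply/funext => x; rewrite mul0r addr0.
(* Either alternative makes [N] negative for small [s > 0]: by continuity, or by descent from
   [N v <= 0]. *)
have first_order d : (forall x, v x = 0 -> 0 <= d x) ->
    N v < 0 \/ dN d < 0 -> 0 <= dH d.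
  move=> d0 Nd; rewrite leNgt; apply/negP => dHlt0.
  have DN : is_derive (0 : R) 1 (fun s => N (fun x => v x + s * d x)) (dN d).
    apply: is_deriveD; first exact: is_derive_energy.
    exact: (@is_derive_potential R V (fun x => - m x) v d p _ Dp).
  have DH : is_derive (0 : R) 1 (fun s => H (fun x => v x + s * d x)) (dH d).
    exact: (@is_derive_potential R V m v d h _ Dh).
  have DL : is_derive (0 : R) 1 (fun s => - 1 * L (fun x => v x + s * d x))
      (- 1 * \sum_x 1 * (d x * 1)).
    apply: is_derive_cstM.
    by apply: (@is_derive_potential R V (fun=> 1) v d (fun=> id) (fun _ _ => 1)).
  have nN : \forall s \near 0^'+, N (fun x => v x + s * d x) < 0.
    case: Nd => [Nd|Nd]; first by apply: (near_right_lt DN); rewrite line0.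
    apply: filterS (near_right_lt_of_derive_lt0 DN Nd) => s.
    by rewrite line0 => /lt_le_trans; exact.
  have nH := near_right_lt_of_derive_lt0 DH dHlt0.
  have nL : \forall s \near 0^'+, - 1 * L (fun x => v x + s * d x) < - e.
    by apply: (near_right_lt DL); rewrite line0 mulN1r ltrN2.
  near (0 : R)^'+ => s.
  have : H (fun x => v x + s * d x) < H (fun x => v x + 0 * d x) by near: s.
  rewrite ltNge => /negP; apply; rewrite line0; apply: vmin.
    split => /=; first by apply: ltW; near: s.
    by rewrite -lerN2 -mulN1r ltW//; near: s.
  by near: s; apply: near_right_box => // x /eqP; rewrite (negPf (vM x)).
pose S := dH v.
have S0 : 0 < S.
  have nn x : 0 <= m x * (v x * ((v x * g' x (v x) - g x (v x)) / 2)).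
    rewrite mulr_ge0 ?(ltW (m_gt0 x))// mulr_ge0// divr_ge0//.
    by rewrite (le_trans _ (superlinear x (v0 x)))// mulr_ge0 ?sqr_ge0 ?(ltW (c_gt0 x)).
  rewrite /S /dH (bigD1 z)//= ltr_pwDl//; last exact: sumr_ge0.
  rewrite !mulr_gt0// ?invr_gt0//.
  by rewrite (lt_le_trans _ (superlinear z (v0 z)))// mulr_gt0// exprn_gt0.
(* If [N v < 0], moving along [- v] would stay admissible and lower [H] at rate [S]. *)
have N0 : N v = 0.
  apply/eqP; rewrite eq_le Nv/= leNgt; apply/negP => Nlt0.
  have : 0 <= dH (fun x => - v x).
    by apply: first_order; [move=> x ->; rewrite oppr0|left].
  have -> : dH (fun x => - v x) = - S.
    by rewrite /S /dH -sumrN; apply: eq_bigr => x _; ring.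
  by rewrite oppr_ge0 leNgt S0.
have dNH d : dN d = 2 * dJ d - 2 * dH d.
  rewrite /dN /dJ /dH !mulr_sumr -sumrB -big_split/=.
  by apply: eq_bigr => x _; field.
have dJv : dJ v = 0.
  rewrite -N0 /dJ /N /energy -big_split/=.
  by apply: eq_bigr => x _; rewrite /p; ring.
have dJ_ge0 d : (forall x, v x = 0 -> 0 <= d x) -> 0 <= dJ d.
  move=> d0; rewrite leNgt; apply/negP => dJlt0.
  (* As [dN v = - 2 S] and [dH v = S], adding [tau *: v] to [d] leaves [dJ d]
     unchanged, while this [tau] makes both [dN] and [dH] negative. *)
  pose tau := (dJ d / 2 - dH d) / S.
  pose d' x := d x + tau * v x.
  have dJ' : dJ d' = dJ d.
    rewrite -[RHS]addr0 -[X in _ + X](mulr0 tau) -dJv /dJ mulr_sumr -big_split/=.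
    by apply: eq_bigr => x _; rewrite /d'; ring.
  have dH' : dH d' = dJ d / 2.
    have -> : dH d' = dH d + tau * S.
      rewrite /S /dH mulr_sumr -big_split/=.
      by apply: eq_bigr => x _; rewrite /d'; ring.
    by rewrite /tau divfK ?gt_eqF//; ring.
  have : 0 <= dH d'.
    apply: first_order; last by right; rewrite dNH dJ' dH'; lra.
    by move=> x vx; rewrite /d' vx mulr0 addr0 d0.
  by rewrite dH'; lra.
have lo x : 0 <= lap k v x - m x * g x (v x).
  rewrite -[leRHS]mul1r -(sum_delta (fun x => lap k v x - m x * g x (v x))).
  by apply: dJ_ge0 => y _; case: ifP.
exists v; split; first by exists z; rewrite gt_eqF.
move=> x; apply/eqP; rewrite -subr_eq0 eq_le lo andbT.
(* Where [v x = 0] the downward direction is not admissible; the maximum principle at this minimum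
   and [g x 0 = 0] give the missing inequality. *)
have [vx|vx] := eqVneq (v x) 0.
  by rewrite vx g0 mulr0 subr0; apply: lap_le0 => // y; rewrite vx.
rewrite -oppr_ge0 -mulN1r -(sum_delta (fun x => lap k v x - m x * g x (v x))).
apply: dJ_ge0 => y vy; case: eqP => // yx.
by move: vx; rewrite -yx vy eqxx.
Unshelve. all: by end_near. Qed.
End Nehari.

(** * Calculus and estimates for the exponential terms *)

Section Exponential.
Local Open Scope classical_set_scope.
Variable R : realType.
Implicit Types a b A B s t : R.

(** The decaying term of the equation is the same expression with [- B] for [A]. *)
Definition expdiff a A t : R := a * expR (A * t) * (expR (A * t) - 1).
Definition expdiff' a A t : R :=
  a * A * expR (A * t) * (2 * expR (A * t) - 1).
Definition expdiff_primitive a A t : R := a / (2 * A) * (expR (A * t) - 1) ^+ 2.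

Lemma is_derive_expRM A t :
  is_derive t 1 (fun t => expR (A * t)) (A * expR (A * t)).
Proof.
rewrite mulrC; apply: (@is_derive1_comp R expR (fun t => A * t)).
have D := is_derive_cstM A (@is_derive_id R R^o t 1).
by apply: (is_derive_eq (df := _) D); rewrite mulr1.
Qed.

Lemma is_derive_expdiff a A t :
  is_derive t 1 (expdiff a A) (expdiff' a A t).
Proof.
have DE := is_derive_expRM A t.
have D := is_derive_cstM a (is_deriveB (is_deriveM DE DE) DE).
have -> : expdiff a A = (fun t => a * ((fun t => expR (A * t)) *
    (fun t => expR (A * t)) - (fun t => expR (A * t))) t).
  by apply/funext => s; rewrite !fctE /expdiff; ring.
apply: (is_derive_eq (df := _) D).
by rewrite /GRing.scale/= /expdiff'; ring.
Qed.

Lemma is_derive_expdiff_primitive a A t : A != 0 ->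
  is_derive t 1 (expdiff_primitive a A) (expdiff a A t).
Proof.
move=> A0; have DE := is_deriveB (is_derive_expRM A t) (@is_derive_cst R R^o R^o 1 t 1).
have D := is_derive_cstM (a / (2 * A)) (is_deriveM DE DE).
have -> : expdiff_primitive a A = (fun t => a / (2 * A) *
    (((fun t => expR (A * t)) - cst 1) * ((fun t => expR (A * t)) - cst 1)) t).
  by apply/funext => s; rewrite !fctE /expdiff_primitive; ring.
apply: (is_derive_eq (df := _) D).
by rewrite !fctE /GRing.scale/= /expdiff subr0; field.
Qed.

(** With [s = A * t], [a] times the right side is [t * expdiff' a A t - expdiff a A t]. The second
    factor is at least [s ^+ 2]: for [2 * s >= 1] by [1 + s <= expR s], otherwise by multiplying it
    by [1 - s] and using [expR s * (1 - s) <= 1]. *)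
Lemma expR_superlinear_ge0 s : 0 <= s ->
  s ^+ 2 <= expR s * (expR s * (2 * s - 1) - (s - 1)).
Proof.
move=> s0; set E := expR s.
have E1 : 1 + s <= E := expR_ge1Dx s.
suff H : s ^+ 2 <= E * (2 * s - 1) - (s - 1).
  apply: (le_trans H); rewrite ler_peMl ?(le_trans (sqr_ge0 s) H)//; lra.
have [s1|s1] := leP 1 (2 * s); first by nra.
have E2 : E * (1 - s) <= 1.
  rewrite -ler_pdivlMl ?expR_gt0// -expRN mulr1.
  exact: expR_ge1Dx.
set Y := E * (2 * s - 1) - (s - 1).
have Y1 : s ^+ 2 <= (1 - s) * Y.
  have : 0 <= (1 - E * (1 - s)) * (1 - 2 * s) by rewrite mulr_ge0; lra.
  by rewrite /Y; lra.
have Y0 : 0 <= Y.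
  by rewrite -(pmulr_rge0 _ (_ : 0 < 1 - s)) ?(le_trans (sqr_ge0 s))//; lra.
by apply: (le_trans Y1); nra.
Qed.

(** Now [1 - s] is always positive, so multiplying by it settles the sign without a case split. *)
Lemma expR_superlinear_le0 s : s <= 0 ->
  0 <= expR s * (expR s * (2 * s - 1) - (s - 1)).
Proof.
move=> s0; rewrite mulr_ge0 ?expR_ge0//.
have : 1 + - s <= expR (- s) := expR_ge1Dx (- s).
rewrite expRN => E1.
have E0 := expR_gt0 s.
have E2 : expR s * (1 - s) <= 1.
  by rewrite -ler_pdivlMl// mulr1.
have : 0 <= (1 - expR s * (1 - s)) * (1 - 2 * s) by rewrite mulr_ge0; lra.
suff : 0 <= (1 - s) * (expR s * (2 * s - 1) - (s - 1)) ->
    0 <= expR s * (2 * s - 1) - (s - 1).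
  move=> + H; apply; nra.
by rewrite pmulr_rge0//; lra.
Qed.

Lemma expdiff_superlinear a A t : 0 <= a -> 0 <= A * t ->
  a * (A * t) ^+ 2 <= t * expdiff' a A t - expdiff a A t.
Proof.
move=> a0 At0.
have := ler_wpM2l a0 (expR_superlinear_ge0 At0).
by rewrite /expdiff' /expdiff; lra.
Qed.

Lemma expdiff_superlinear_le0 a A t : 0 <= a -> A * t <= 0 ->
  0 <= t * expdiff' a A t - expdiff a A t.
Proof.
move=> a0 At0.
have := mulr_ge0 a0 (expR_superlinear_le0 At0).
by rewrite /expdiff' /expdiff; lra.
Qed.

Lemma expdiff_ge a A t : 0 <= a -> 0 <= A * t -> a * (A * t) <= expdiff a A t.
Proof.
move=> a0 At0; rewrite /expdiff -mulrA ler_wpM2l//.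
by have := expR_ge1Dx (A * t); nra.
Qed.

(** Complete the square in [E ^+ 2 - E + 1], where [E = expR (A * t)]. *)
Lemma expdiff_geN a A t : 0 <= a -> - a <= expdiff a A t.
Proof.
move=> a0; rewrite /expdiff.
have : 0 <= a * ((expR (A * t) - 2^-1) ^+ 2 + 3 / 4).
  by rewrite mulr_ge0// addr_ge0 ?sqr_ge0//; lra.
lra.
Qed.

Lemma expdiff0 a A : expdiff a A 0 = 0.
Proof. by rewrite /expdiff mulr0 expR0 subrr mulr0. Qed.

End Exponential.

(** * The nonlinearity combining both exponential terms *)

Section Nonlinearity.
Local Open Scope classical_set_scope.
Variables (R : realType) (V : finType) (a b : V -> R) (A B : R).
Hypotheses (a_gt0 : forall x, 0 < a x) (b_gt0 : forall x, 0 < b x).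
Hypotheses (A_gt0 : 0 < A) (B_gt0 : 0 < B).
Hypothesis aAbB : forall x, a x * A < b x * B.

Definition nonlin x (t : R) := expdiff (a x) A t + expdiff (b x) (- B) t.
Let nonlin' x (t : R) := expdiff' (a x) A t + expdiff' (b x) (- B) t.
Let primitive x (t : R) :=
  expdiff_primitive (a x) A t + expdiff_primitive (b x) (- B) t.

Let Dnonlin x (t : R) : is_derive t 1 (nonlin x) (nonlin' x t).
Proof. by apply: is_deriveD; exact: is_derive_expdiff. Qed.

Let Dprimitive x (t : R) : is_derive t 1 (primitive x) (nonlin x t).
Proof.
by apply: is_deriveD; apply: is_derive_expdiff_primitive;
  rewrite ?oppr_eq0 gt_eqF.
Qed.

Let nonlin0 x : nonlin x 0 = 0.
Proof. by rewrite /nonlin !expdiff0 addr0. Qed.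

(** The slope at [0] is [a x * A - b x * B], negative by [aAbB]; finiteness of [V] gives a common
    [e]. *)
Lemma nonlin_neg_near0 : exists2 e, 0 < e &
  forall x t, 0 < t -> t <= e -> nonlin x t < 0.
Proof.
have : \forall s \near 0^'+, forall x, nonlin x s < 0.
  apply: filter_forall => x.
  suff : \forall s \near 0^'+, nonlin x s < nonlin x 0 by rewrite nonlin0.
  apply: (near_right_lt_of_derive_lt0 (Dnonlin x 0)).
  rewrite /nonlin' /expdiff' !mulr0 expR0; have := aAbB x; lra.
move=> [e /= e0 He]; exists (e / 2); first by rewrite divr_gt0.
move=> x t t0 te; apply: He => //=.
by rewrite sub0r normrN gtr0_norm//; lra.
Qed.

(** The first term is at least [a x * A * K], while the second never falls below [- b x]. *)
Lemma nonlin_pos_at : exists2 K, 0 < K & forall x, 0 < nonlin x K.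
Proof.
near (pinfty_nbhs R) => K.
have K0 : 0 < K by near: K; apply: nbhs_pinfty_gt; exact: num_real.
exists K => // x.
have : b x / (a x * A) < K.
  move: x; near: K; apply: filter_forall => x.
  by apply: nbhs_pinfty_gt; exact: num_real.
rewrite ltr_pdivrMr ?mulr_gt0// => bK.
have := @expdiff_ge R (a x) A K (ltW (a_gt0 x)) (ltW (mulr_gt0 A_gt0 K0)).
by have := @expdiff_geN R (b x) (- B) K (ltW (b_gt0 x)); rewrite /nonlin; lra.
Unshelve. all: by end_near. Qed.

(** The growing exponential supplies the whole bound; the decaying one contributes a nonnegative
    amount. *)
Let nonlin_superlinear x t : 0 <= t ->
  a x * A ^+ 2 * t ^+ 2 <= t * nonlin' x t - nonlin x t.
Proof.
move=> t0.
have := @expdiff_superlinear R (a x) A t (ltW (a_gt0 x)) (mulr_ge0 (ltW A_gt0) t0).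
have := @expdiff_superlinear_le0 R (b x) (- B) t (ltW (b_gt0 x)).
have Bt : - B * t <= 0 by rewrite mulNr oppr_le0 mulr_ge0// ltW.
by move=> /(_ Bt); rewrite /nonlin /nonlin'; lra.
Qed.

Variables (k : V -> V -> R) (m : V -> R) (x0 : V).
Hypotheses (k_sym : forall x y, k x y = k y x) (k_ge0 : forall x y, 0 <= k x y).
Hypothesis m_gt0 : forall x, 0 < m x.

Lemma nonzero_solution_absorbing : exists v : V -> R, v <> (fun=> 0) /\
  forall x, lap k v x + m x * nonlin x (v x) = 0.
Proof.
have [e e0 ge] := nonlin_neg_near0.
have [K K0 gK] := nonlin_pos_at.
have eK : e <= K.
  by rewrite leNgt; apply/negP => /ltW /(ge x0 _ K0); rewrite ltNge ltW.
have [|v [ve Hv]] :=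
  solution_between_constants k_sym k_ge0 m_gt0 Dprimitive eK _ gK.
  by move=> x; exact: ge.
exists v; split => // v_eq0.
by have := lt_le_trans e0 (ve x0); rewrite v_eq0 ltxx.
Qed.

Lemma nonzero_solution_source : exists v : V -> R, v <> (fun=> 0) /\
  forall x, lap k v x = m x * nonlin x (v x).
Proof.
have [e e0 ge] := nonlin_neg_near0.
have [K K0 gK] := nonlin_pos_at.
have prim0 x : primitive x 0 = 0.
  by rewrite /primitive /expdiff_primitive !mulr0 expR0 subrr expr0n !mulr0 addr0.
have [||v [[z vz] Hv]] := nehari_solution k_sym k_ge0 m_gt0 Dprimitive Dnonlin
  nonlin0 prim0 (c := fun x => a x * A ^+ 2) _ nonlin_superlinear x0 e0 ge K0.
- by move=> x; rewrite mulr_gt0 ?exprn_gt0.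
- by move=> x; exact: ltW.
by exists v; split => // v_eq0; move: vz; rewrite v_eq0 eqxx.
Qed.

End Nonlinearity.

(** * Two solutions of the graph equation *)

Theorem theorem3 (R : realType) (V : finType) (x0 : V) (E : rel V)
    (mu : V -> R) (w : V -> V -> R) (h1 h2 : V -> R) (A B : R)
    (graphE : simple_graph E) (connE : connected_graph E)
    (mu_gt0 : forall x, 0 < mu x) (wE : edge_weights E w)
    (h1_gt0 : forall x, 0 < h1 x) (h2_gt0 : forall x, 0 < h2 x)
    (A_gt0 : 0 < A) (B_gt0 : 0 < B)
    (hAB : A * maxV x0 h1 < B * minV x0 h2 \/
           A * minV x0 h1 > B * maxV x0 h2) :
  exists u1 u2 : V -> R,
    u1 <> u2 /\
    is_solution E mu w h1 h2 A B u1 /\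
    is_solution E mu w h1 h2 A B u2.
Proof.
(* Extension by zero gives a symmetric kernel on all of [V], whatever [w] is off the edges. *)
pose k x y := if E x y then w x y else 0.
have k_sym x y : k x y = k y x.
  rewrite /k (graphE.1 y x); case: ifP => // Exy.
  by have [] := wE _ _ Exy.
have k_ge0 x y : 0 <= k x y.
  by rewrite /k; case: ifP => // Exy; have [_ /ltW] := wE _ _ Exy.
have lapE u x : laplacian E mu w u x = - (mu x)^-1 * lap k u x.
  rewrite /laplacian /lap big_mkcond mulNr -mulrN -sumrN; congr (_ * _).
  by apply: eq_bigr => y _; rewrite /k; case: ifP => _; ring.
have lap0 x : lap k (fun=> 0) x = 0.
  by rewrite /lap big1// => y _; rewrite subrr mulr0.
suff [u [u_neq0 Hu]] : exists u, u <> (fun=> 0) /\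
    is_solution E mu w h1 h2 A B u.
  exists u, (fun=> 0); split => //; split => // x.
  by rewrite lapE lap0 !mulr0 expR0 subrr; ring.
have max_ge h x : h x <= maxV x0 h by exact: le_bigmax.
have min_le h x : minV x0 h <= h x by exact: bigmin_le.
case: hAB => hAB.
  have hx x : h1 x * A < h2 x * B.
    rewrite [ltLHS]mulrC [ltRHS]mulrC.
    apply: le_lt_trans (lt_le_trans hAB _);
      first by apply: ler_wpM2l; [exact: ltW|exact: max_ge].
    by apply: ler_wpM2l; [exact: ltW|exact: min_le].
  have [u [u0 Hu]] := nonzero_solution_absorbing h1_gt0 h2_gt0 A_gt0 B_gt0 hx
    x0 k_sym k_ge0 mu_gt0.
  exists u; split => // x; rewrite lapE.
  have mx := lt0r_neq0 (mu_gt0 x).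
  have -> : lap k u x = - (mu x * nonlin h1 h2 A B x (u x)).
    by apply/eqP; rewrite -addr_eq0 Hu.
  by rewrite /nonlin /expdiff; field.
have hx x : h2 x * B < h1 x * A.
  rewrite [ltLHS]mulrC [ltRHS]mulrC.
  apply: le_lt_trans (lt_le_trans hAB _);
      first by apply: ler_wpM2l; [exact: ltW|exact: max_ge].
  by apply: ler_wpM2l; [exact: ltW|exact: min_le].
have [v [v0 Hv]] := nonzero_solution_source h2_gt0 h1_gt0 B_gt0 A_gt0 hx
  x0 k_sym k_ge0 mu_gt0.
(* The sign change swaps the two exponentials, matching [nonlin h2 h1 B A]. *)
exists (fun x => - v x); split => [vN|x].
  apply: v0; apply/funext => x; have /= /eqP := congr1 (@^~ x) vN.
  by rewrite oppr_eq0 => /eqP.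
have mx := lt0r_neq0 (mu_gt0 x).
have lapN : lap k (fun x => - v x) x = - lap k v x.
  by rewrite /lap -sumrN; apply: eq_bigr => y _; ring.
have -> : A * - v x = - A * v x by ring.
have -> : - B * - v x = B * v x by ring.
by rewrite lapE lapN Hv /nonlin /expdiff; field.
Qed.
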